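(* Let $q$ be a prime power and $n$ a non-negative integer. (1) For any coordinate $q$-matroid on $\mathbb{F}_q^n$ with weighted cyclic flats $(\mathcal{Z},\lambda)$, there is a matroid on $[n]$ with weighted cyclic flats $(\phi^{-1}(\mathcal{Z}),\lambda\circ\phi)$. (2) For any matroid on $[n]$ with weighted cyclic flats $(\mathcal{Z},\lambda)$, there is a coordinate $q$-matroid on $\mathbb{F}_q^n$ with weighted cyclic flats $(\phi(\mathcal{Z}),\lambda\circ\phi^{-1})$.
   Context: A $q$-matroid $M=(E,\rho)$ consists of a finite-dimensional vector space $E$ over a finite field $\mathbb{F}_q$ and a function $\rho$ from the set of subspaces of $E$ to $\mathbb{Z}_{\ge 0}$ such that for all $X,Y\le E$: $0\le\rho(X)\le\dim X$; $X\le Y$ implies $\rho(X)\le\rho(Y)$; and $\rho(X+Y)+\rho(X\cap Y)\le\rho(X)+\rho(Y)$. A subspace $X$ is a flat if $\rho(X)<\rho(X\oplus\langle v\rangle)$ for all $v\in E\setminus X$; it is cyclic if $\rho(H)=\rho(X)$ for every subspace $H\le X$ with $\dim H=\dim X-1$; it is a cyclic flat if it is both. Analogously for a matroid $(S,r)$: $X\subseteq S$ is a flat if $r(X)<r(X\cup\{s\})$ for all $s\in S\setminus X$, cyclic if $r(X\setminus\{x\})=r(X)$ for all $x\in X$, a cyclic flat if both. The weighted cyclic flats of a matroid or $q$-matroid are the pair $(\mathcal{Z},\lambda)$, where $\mathcal{Z}$ is the set of its cyclic flats and $\lambda$ is the restriction of the rank function to $\mathcal{Z}$. A subspace of $\mathbb{F}_q^n$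 is coordinate if it is spanned by a subset of the standard basis vectors $e_1,\dots,e_n$. A coordinate $q$-matroid is a $q$-matroid on $\mathbb{F}_q^n$ all of whose cyclic flats are coordinate subspaces. For $S\subseteq[n]$ let $\phi(S)=\langle e_i:i\in S\rangle$; for a coordinate subspace $X$, $\phi^{-1}(X)$ is the unique $S\subseteq[n]$ with $\phi(S)=X$. For a collection $\mathcal{Z}$, $\phi(\mathcal{Z})=\{\phi(Z):Z\in\mathcal{Z}\}$ and $\phi^{-1}(\mathcal{Z})=\{\phi^{-1}(Z):Z\in\mathcal{Z}\}$. *)

(* Defs.v *)
From mathcomp Require Import all_boot all_order all_algebra.
From mathcomp Require Import classical_sets.

Set Implicit Arguments.
Unset Strict Implicit.
Unset Printing Implicit Defensive.

Import GRing.Theory.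
Local Open Scope ring_scope.

Record matroid (T : finType) := Matroid {
  rank :> {set T} -> nat;
  rank_card : forall X, (rank X <= #|X|)%N;
  rank_mono : forall X Y : {set T}, X \subset Y -> (rank X <= rank Y)%N;
  rank_submod : forall X Y : {set T},
    (rank (X :|: Y) + rank (X :&: Y) <= rank X + rank Y)%N }.

Record qmatroid (F : finFieldType) (E : vectType F) := QMatroid {
  qrank :> {vspace E} -> nat;
  qrank_dim : forall X, (qrank X <= \dim X)%N;
  qrank_mono : forall X Y : {vspace E}, (X <= Y)%VS -> (qrank X <= qrank Y)%N;
  qrank_submod : forall X Y : {vspace E},
    (qrank (X + Y)%VS + qrank (X :&: Y)%VS <= qrank X + qrank Y)%N }.

Section MatroidCyclicFlats.
Variables (T : finType) (M : matroid T).
Implicit Type X : {set T}.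

Definition flat X : Prop := forall s, s \notin X -> (M X < M (s |: X))%N.

Definition cyclic X : Prop := forall x, x \in X -> M (X :\ x) = M X.

Definition cyclic_flat X : Prop := flat X /\ cyclic X.

(* The weight [lam] is a total function of which only the values on [Z] are
   meaningful. *)
Definition weighted_cyclic_flats (Z : set {set T}) (lam : {set T} -> nat) :=
  Z = [set X | cyclic_flat X]%classic /\ (forall X, Z X -> lam X = M X).

End MatroidCyclicFlats.

Section QMatroidCyclicFlats.
Variables (F : finFieldType) (E : vectType F) (M : qmatroid E).
Implicit Type X : {vspace E}.

Definition qflat X : Prop := forall v, v \notin X -> (M X < M (X + <[v]>)%VS)%N.

(* Hyperplanes are described by [(\dim H).+1 = \dim X]: with truncated
   subtraction, 0 would wrongly be a hyperplane of itself. *)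
Definition qcyclic X : Prop :=
  forall H : {vspace E}, (H <= X)%VS -> (\dim H).+1 = \dim X -> M H = M X.

Definition qcyclic_flat X : Prop := qflat X /\ qcyclic X.

Definition qweighted_cyclic_flats (Z : set {vspace E})
    (lam : {vspace E} -> nat) :=
  Z = [set X | qcyclic_flat X]%classic /\ (forall X, Z X -> lam X = M X).

End QMatroidCyclicFlats.

Section Coordinate.
Variables (F : finFieldType) (n : nat).

Definition std_basis (i : 'I_n) : 'rV[F]_n := delta_mx 0 i.

Definition phi (S : {set 'I_n}) : {vspace 'rV[F]_n} :=
  <<[seq std_basis i | i in S]>>%VS.

Definition coordinate (X : {vspace 'rV[F]_n}) : Prop := exists S, X = phi S.

(* The unique [S] with [phi S = X] when [X] is coordinate (see [phiK]);
   the value [set0] on other subspaces is irrelevant. *)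
Definition phi_inv (X : {vspace 'rV[F]_n}) : {set 'I_n} :=
  odflt finset.set0 [pick S | phi S == X].

Lemma mem_phi (S : {set 'I_n}) (i : 'I_n) :
  (std_basis i \in phi S) = (i \in S).
Proof.
apply/idP/idP => [|iS]; last by apply: memv_span; exact: fintype.image_f.
apply: contraLR => iNS; apply/negP => /(@coord_span _ _ _ (in_tuple _)).
move=> /rowP /(_ i); rewrite mxE !eqxx summxE big1 => [/eqP|k _].
  by rewrite oner_eq0.
rewrite mxE; set t := _`_k.
have /fintype.imageP[j jS ->] : t \in [seq std_basis i | i in S] by exact: mem_nth.
by rewrite mxE eqxx /=; case: eqP iNS => [->|_]; rewrite ?jS // mulr0.
Qed.

Lemma phiK : cancel phi phi_inv.
Proof.
move=> S; rewrite /phi_inv; case: pickP => [S' /eqP eqS|/(_ S)] /=.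
  by apply/setP => i; rewrite -!mem_phi eqS.
by rewrite eqxx.
Qed.

Definition coordinate_qmatroid (M : qmatroid 'rV[F]_n) : Prop :=
  forall X, qcyclic_flat M X -> coordinate X.

End Coordinate.

(* Main.v *)
(** The link between the two structures is the rank formula
    [rho X = min_Z (rho Z + dim (X + Z) - dim Z)], [Z] ranging over the cyclic
    flats.  For (1), restrict [rho] to coordinate subspaces; if [S] is a cyclic
    flat of this restriction, a cyclic flat attaining the minimum for [phi S] is
    coordinate and is forced to be [phi S].  For (2), set
    [rho X = min_S (r S + dim (X + phi S) - #|S|)], [S] ranging over all
    subsets: submodularity then follows from that of [r] and the modular law,
    without knowing the lattice structure of the cyclic flats, and a subset
    attaining the minimum at a cyclic flat [X] satisfies [phi S = X]. *)

Require Import Defs.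
From mathcomp Require Import all_boot all_order all_algebra.
From mathcomp Require Import classical_sets.
From mathcomp Require Import boolp zify.

Set Implicit Arguments.
Unset Strict Implicit.
Unset Printing Implicit Defensive.

(** * Hyperplanes and dimension counts *)

Section VectorSpace.
Variables (F : fieldType) (E : vectType F).
Implicit Types H U V X : {vspace E}.

(** Split a line [<[v]>] off a complement of [U] in [X]; then [H] is [U] plus a complement of [U +
    <[v]>]. *)
Lemma exists_hyperplane U X : (U <= X)%VS -> (\dim U < \dim X)%N ->
  exists H, [/\ (U <= H)%VS, (H <= X)%VS & (\dim H).+1 = \dim X].
Proof.
move=> UX ltUX; set v := vpick (X :\: U)%VS.
have dD : (\dim X - \dim U)%N = \dim (X :\: U).
  by have := dimv_cap_compl X U; rewrite (capv_idPr UX); lia.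
have v0 : v != 0%R by rewrite vpick0 -dimv_eq0; lia.
have vD : v \in (X :\: U)%VS by exact: memv_pick.
have vX : (<[v]> <= X)%VS.
  by rewrite -memvE; apply: subvP vD; exact: diffvSl.
have vU : (U :&: <[v]>)%VS = 0%VS.
  by apply/eqP; rewrite -subv0 capvC -(capv_diff X U); exact: capvS.
have dUv : \dim (U + <[v]>) = (\dim U).+1.
  by have := dimv_sum_cap U <[v]>%VS; rewrite vU dimv0 dim_vline v0; lia.
have UvX : (U + <[v]> <= X)%VS by rewrite subv_add UX.
set W := (X :\: (U + <[v]>))%VS.
have dW : (\dim W + (\dim U).+1)%N = \dim X.
  by have := dimv_cap_compl X (U + <[v]>)%VS; rewrite (capv_idPr UvX) dUv -/W; lia.
have HX : (U + W <= X)%VS by rewrite subv_add UX diffvSl.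
exists (U + W)%VS; split; rewrite ?addvSl //.
have eX : (U + W + <[v]>)%VS = X.
  rewrite -addvA [(W + _)%VS]addvC addvA addvC /W addv_diff.
  exact/addv_idPl.
have := dimv_sum_cap U W.
have := dimv_sum_cap (U + W)%VS <[v]>%VS; rewrite eX dim_vline v0; lia.
Qed.

Lemma dimv_addl U V : (\dim U <= \dim (U + V))%N.
Proof. exact/dimvS/addvSl. Qed.

Lemma dimv_addr U V : (\dim V <= \dim (U + V))%N.
Proof. exact/dimvS/addvSr. Qed.

Lemma dimv_add_hyperplane H X U : (H <= X)%VS -> (\dim H).+1 = \dim X ->
  (\dim (X + U) <= (\dim (H + U)).+1)%N.
Proof.
move=> HX dH; have := dimvS (capvS HX (subvv U)).
by have := dimv_sum_cap H U; have := dimv_sum_cap X U; lia.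
Qed.

Lemma dimv_add_vline X v : v \notin X -> \dim (X + <[v]>) = (\dim X).+1.
Proof.
move=> vX; have v0 : v != 0%R by apply: contraNneq vX => ->; exact: mem0v.
have := dimv_sum_cap X <[v]>%VS; rewrite dim_vline v0.
suff -> : (X :&: <[v]>)%VS = 0%VS by rewrite dimv0; lia.
apply/eqP; rewrite -subv0; apply/subvP => w; rewrite memv_cap => /andP[wX].
case/vlineP => k wE; move: wX; rewrite wE memv0.
by rewrite GRing.rpredZeq (negPf vX) orbF => /eqP ->; rewrite GRing.scale0r.
Qed.

End VectorSpace.

(** * Nullity, flats and cyclic sets of a matroid *)

Section Matroid.
Variables (T : finType) (N : matroid T).
Implicit Types S A : {set T}.

(** Nullity (size minus rank) is monotone: apply submodularity to [A] and [S :\: A], whose rank is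
    at most its size. *)
Lemma rank_le_codim A S : A \subset S -> (N S + #|A| <= N A + #|S|)%N.
Proof.
move=> AS; have := rank_submod N A (S :\: A); have := rank_card N (S :\: A).
have -> : A :|: S :\: A = S.
  apply/setP => x; rewrite !inE; have := fintype.subsetP AS x.
  by case: (x \in A) => //= ->.
by rewrite cardsD (finset.setIidPr AS); have := subset_leq_card AS; lia.
Qed.

Lemma flat_sub A S : flat N S -> (N (A :|: S) <= N S)%N -> A \subset S.
Proof.
move=> flS le; apply/fintype.subsetP => s sA; apply/negPn/negP => /flS.
rewrite ltnNge; apply/negP/negPn; apply: leq_trans le.
by apply: rank_mono; rewrite finset.setSU // finset.sub1set.
Qed.

(** A point of [S] outside [A] could be deleted without loss of rank, leaving a set that contains
    [A] but has smaller nullity. *)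
Lemma cyclic_sub A S :
  cyclic N S -> A \subset S -> (N A + #|S| <= N S + #|A|)%N -> A = S.
Proof.
move=> cyS AS le; apply/eqP; rewrite finset.eqEsubset AS /=.
apply/fintype.subsetP => s sS.
apply/negPn/negP => sA; have := cyS s sS.
have /rank_le_codim : A \subset S :\ s by rewrite subsetD1 AS.
by have := cardsD1 s S; rewrite sS; lia.
Qed.

End Matroid.

(** * The rank of a q-matroid through its cyclic flats *)

Section QMatroid.
Variables (F : finFieldType) (E : vectType F) (M : qmatroid E).
Implicit Types H U W X Y : {vspace E}.

Lemma qrank_le_codim U W : (U <= W)%VS -> (M W + \dim U <= M U + \dim W)%N.
Proof.
move=> UW; have := qrank_submod M U (W :\: U)%VS.
rewrite addvC addv_diff (addv_idPl UW).
have := qrank_dim M (W :\: U)%VS.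
have := dimv_cap_compl W U; rewrite (capv_idPr UW); lia.
Qed.

Lemma qflat_sub U X : qflat M X -> (M (X + U)%VS <= M X)%N -> (U <= X)%VS.
Proof.
move=> flX le; apply/subvP => v vU; apply/negPn/negP => /flX.
rewrite ltnNge; apply/negP/negPn; apply: leq_trans le.
by apply: qrank_mono; rewrite addvS // -memvE.
Qed.

Lemma qcyclic_sub U X :
  qcyclic M X -> (U <= X)%VS -> (M U + \dim X <= M X + \dim U)%N -> U = X.
Proof.
move=> cyX UX le; apply/eqP; rewrite eqEdim UX leqNgt; apply/negP.
case/(exists_hyperplane UX) => H [UH HX dH].
by have := cyX _ HX dH; have := qrank_le_codim UH; lia.
Qed.

Lemma exists_closure X : exists Y, [/\ qflat M Y, (X <= Y)%VS & M Y = M X].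
Proof.
have [k] := ubnP (\dim {:E} - \dim X); elim: k X => // k IH X lek.
have [flX|] := pselect (qflat M X); first by exists X.
case/existsNP => v /not_implyP[vX /negP]; rewrite -leqNgt => le.
have eM : M (X + <[v]>)%VS = M X.
  by apply/eqP; rewrite eqn_leq le /= qrank_mono // addvSl.
have := dimv_add_vline vX; have := dimvS (subvf (X + <[v]>)%VS) => d1 d2.
have [|Y [flY XY eY]] := IH (X + <[v]>)%VS; first by lia.
exists Y; split; rewrite ?eY //; exact: subv_trans (addvSl _ _) XY.
Qed.

Lemma qflat_hyperplane H Y : qflat M Y -> (H <= Y)%VS ->
  (\dim H).+1 = \dim Y -> M H <> M Y -> qflat M H.
Proof.
move=> flY HY dH neq v vH; rewrite ltnNge; apply/negP => le.
have lt : (M H < M Y)%N by rewrite ltn_neqAle qrank_mono // andbT; exact/eqP.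
have [vY|/flY] := boolP (v \in Y).
  suff eY : (H + <[v]>)%VS = Y by rewrite eY in le; lia.
  apply/eqP; rewrite eqEdim subv_add HY -memvE vY /=.
  by rewrite (dimv_add_vline vH) dH.
(* For [v] outside [Y]: if [v] did not raise the rank of [H], it would not raise that of [Y]
   either. *)
have := qrank_submod M Y (H + <[v]>)%VS; rewrite addvA (addv_idPl HY).
have : (M H <= M (Y :&: (H + <[v]>))%VS)%N.
  by apply: qrank_mono; rewrite subv_cap HY addvSl.
lia.
Qed.

(** Descend through hyperplanes of smaller rank: [qflat_hyperplane] keeps flatness, and each step
    lowers rank and dimension by exactly one, so nullity is preserved. *)
Lemma exists_cyclic_core Y : qflat M Y ->
  exists U, [/\ qcyclic_flat M U, (U <= Y)%VS & (M U + \dim Y = M Y + \dim U)%N].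
Proof.
have [k] := ubnP (\dim Y); elim: k Y => // k IH Y lek flY.
have [cyY|] := pselect (qcyclic M Y); first by exists Y.
case/existsNP => H /not_implyP[HY /not_implyP[dH neq]].
have [||U [cfU UH eU]] := IH H; first by lia.
  exact: qflat_hyperplane neq.
exists U; split; rewrite ?(subv_trans UH) //.
have := qrank_le_codim HY; have := qrank_mono M HY; lia.
Qed.

(** The minimum in the rank formula is attained at the cyclic core [U] of a closure [Y] of [X]: [U]
    and [Y] have equal nullity, and [X + U] lies between [X] and [Y], which have equal rank. *)
Lemma qrank_cyclic_flat X : exists U,
  qcyclic_flat M U /\ (M U + \dim (X + U) = M X + \dim U)%N.
Proof.
have [Y [flY XY eY]] := exists_closure X.
have [U [cfU UY eU]] := exists_cyclic_core flY.
exists U; split => //; have := qrank_le_codim (addvSr X U).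
have := qrank_mono M (addvSl X U).
have : (\dim (X + U) <= \dim Y)%N by rewrite dimvS // subv_add XY.
lia.
Qed.

End QMatroid.

(** * Coordinate subspaces as a copy of the subset lattice *)

Section Phi.
Variables (F : finFieldType) (n : nat).
Implicit Types A B S : {set 'I_n}.
Local Notation phi := (@phi F n).

Lemma sub_phi A (X : {vspace 'rV[F]_n}) :
  (forall i, i \in A -> std_basis F i \in X) -> (phi A <= X)%VS.
Proof. by move=> AX; apply/span_subvP => _ /fintype.imageP[i iA ->]; exact: AX. Qed.

Lemma phiS A B : (phi A <= phi B)%VS = (A \subset B).
Proof.
apply/idP/fintype.subsetP => [/subvP AB i iA|AB].
  by rewrite -(mem_phi F); apply: AB; rewrite mem_phi.
by apply: sub_phi => i /AB; rewrite mem_phi.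
Qed.

Lemma phi1 i : phi [set i] = <[std_basis F i]>%VS.
Proof.
apply/eqP; rewrite eqEsubv -memvE mem_phi set11 andbT.
by apply: sub_phi => j; rewrite inE => /eqP ->; exact: memv_line.
Qed.

Lemma phiU A B : phi (A :|: B) = (phi A + phi B)%VS.
Proof.
apply/eqP; rewrite eqEsubv subv_add !phiS finset.subsetUl finset.subsetUr !andbT.
apply: sub_phi => i; rewrite finset.in_setU => /orP[] iA.
  by apply: subvP (addvSl _ _) _ _; rewrite mem_phi.
by apply: subvP (addvSr _ _) _ _; rewrite mem_phi.
Qed.

Lemma phiT : phi [set: 'I_n] = fullv.
Proof.
apply/eqP; rewrite eqEsubv subvf; apply/subvP => v _.
rewrite (matrix.row_sum_delta v); apply: memv_suml => i _.
by apply: memvZ; rewrite (mem_phi F [set: 'I_n] i) finset.in_setT.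
Qed.

Lemma dim_phi A : \dim (phi A) = #|A|.
Proof.
have le B : (\dim (phi B) <= #|B|)%N.
  by apply: leq_trans (dim_span _) _; rewrite size_map -cardE.
have : \dim (phi [set: 'I_n]) = n by rewrite phiT dimvf /dim /= mul1n.
(* The upper bounds for [A] and its complement add up to [n], so both are equalities. *)
rewrite -(finset.setUCr A) phiU; have := dimv_sum_cap (phi A) (phi (~: A)).
have := le A; have := le (~: A); have := cardsC A; rewrite card_ord; lia.
Qed.

Lemma phiI A B : phi (A :&: B) = (phi A :&: phi B)%VS.
Proof.
apply/eqP; rewrite eqEdim subv_cap !phiS finset.subsetIl finset.subsetIr /=.
have := dimv_sum_cap (phi A) (phi B); rewrite -phiU !dim_phi.
have := cardsUI A B; lia.
Qed.

End Phi.

(** * From a q-matroid to a matroid: restriction to coordinate subspaces *)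

Section Restriction.
Variables (F : finFieldType) (n : nat) (M : qmatroid 'rV[F]_n).
Local Notation phi := (@phi F n).

Definition coord_rank (S : {set 'I_n}) : nat := M (phi S).

Fact coord_rank_card S : (coord_rank S <= #|S|)%N.
Proof. by rewrite -(dim_phi F) qrank_dim. Qed.

Fact coord_rank_mono (S S' : {set 'I_n}) :
  S \subset S' -> (coord_rank S <= coord_rank S')%N.
Proof. by move=> SS'; apply: qrank_mono; rewrite phiS. Qed.

Fact coord_rank_submod (S S' : {set 'I_n}) :
  (coord_rank (S :|: S') + coord_rank (S :&: S')
     <= coord_rank S + coord_rank S')%N.
Proof. by rewrite /coord_rank phiU phiI qrank_submod. Qed.

Definition coord_matroid : matroid 'I_n :=
  Matroid coord_rank_card coord_rank_mono coord_rank_submod.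

End Restriction.

(** On the matroid side only coordinate lines and coordinate hyperplanes are tested. *)
Lemma qcyclic_flat_phi (F : finFieldType) n (M : qmatroid 'rV[F]_n) S :
  qcyclic_flat M (phi F S) -> cyclic_flat (coord_matroid M) S.
Proof.
case=> flS cyS; split=> [s sS|s sS] /=; rewrite /coord_rank.
  by rewrite phiU addvC phi1; apply: flS; rewrite mem_phi.
by apply: cyS; rewrite ?phiS ?subsetDl // !dim_phi (cardsD1 s S) sS.
Qed.

Lemma coord_cyclic_flatP (F : finFieldType) n (M : qmatroid 'rV[F]_n) S :
  coordinate_qmatroid M ->
  cyclic_flat (coord_matroid M) S <-> qcyclic_flat M (phi F S).
Proof.
move=> coM; split; last exact: qcyclic_flat_phi.
case=> flS cyS; have [U [cfU]] := qrank_cyclic_flat M (phi F S).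
have [A eU] := coM _ cfU; rewrite eU in cfU *; rewrite -phiU !dim_phi => eM.
suff -> : S = A by [].
(* With [eM], this says that [S :|: A] has rank at most that of [S], so flatness puts [A] inside
   [S]. *)
have := rank_le_codim (coord_matroid M) (finset.subsetUr S A).
rewrite /= /coord_rank => le.
have AS : A \subset S.
  by apply: flat_sub flS _; rewrite /= /coord_rank finset.setUC
    -(leq_add2r #|A|) -eM.
apply/esym/(cyclic_sub cyS AS); rewrite /= /coord_rank -eM.
by rewrite (finset.setUidPl AS).
Qed.

(** * From a matroid to a coordinate q-matroid *)

Section Extension.
Variables (F : finFieldType) (n : nat) (N : matroid 'I_n).
Local Notation phi := (@phi F n).
Implicit Types (S A : {set 'I_n}) (X Y : {vspace 'rV[F]_n}).

(* Never truncated: [#|S| = \dim (phi S)] by [dim_phi]. *)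
Definition ext_bound X S : nat := N S + (\dim (X + phi S) - #|S|).

Definition ext_rank X : nat :=
  ext_bound X [arg min_(S < finset.set0) ext_bound X S].

(** With [ext_rank_attained], this characterizes the minimum additively, free of truncated
    subtraction. *)
Lemma ext_rank_le X S : (ext_rank X + #|S| <= N S + \dim (X + phi S))%N.
Proof.
rewrite /ext_rank; case: arg_minnP => // A _ /(_ S isT); rewrite {2}/ext_bound.
have := dimv_addr X (phi S); rewrite dim_phi; lia.
Qed.

Lemma ext_rank_attained X :
  exists S, (ext_rank X + #|S| = N S + \dim (X + phi S))%N.
Proof.
rewrite /ext_rank; case: arg_minnP => // A _ _; exists A; rewrite /ext_bound.
have := dimv_addr X (phi A); rewrite dim_phi; lia.
Qed.

(** The choice [S = A] gives [N A]; any other [S] gives at least [N (A :|: S)], by monotone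
    nullity. *)
Lemma ext_rank_phi A : ext_rank (phi A) = N A.
Proof.
have [S] := ext_rank_attained (phi A); have := ext_rank_le (phi A) A.
have := rank_le_codim N (finset.subsetUr A S).
have := rank_mono N (finset.subsetUl A S).
rewrite -!phiU !dim_phi finset.setUid; lia.
Qed.

Fact ext_rank_dim X : (ext_rank X <= \dim X)%N.
Proof.
have := ext_rank_le X finset.set0; have := rank_card N finset.set0.
have := dimv_sum_cap X (phi finset.set0); rewrite dim_phi cards0; lia.
Qed.

Fact ext_rank_mono X Y : (X <= Y)%VS -> (ext_rank X <= ext_rank Y)%N.
Proof.
move=> XY; have [S] := ext_rank_attained Y; have := ext_rank_le X S.
have : (\dim (X + phi S) <= \dim (Y + phi S))%N by rewrite dimvS // addvS.
lia.
Qed.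

Fact ext_rank_submod X Y :
  (ext_rank (X + Y)%VS + ext_rank (X :&: Y)%VS <= ext_rank X + ext_rank Y)%N.
Proof.
have [S eS] := ext_rank_attained X; have [A eA] := ext_rank_attained Y.
(* The minimizers for [X] and [Y] are combined: their union bounds the sum, their intersection
   bounds the meet. *)
have := ext_rank_le (X + Y)%VS (S :|: A).
have := ext_rank_le (X :&: Y)%VS (S :&: A).
have := dimv_sum_cap (X + phi S) (Y + phi A).
have -> : (X + phi S + (Y + phi A) = X + Y + phi (S :|: A))%VS.
  by rewrite phiU !addvA; congr (_ + _)%VS; rewrite -!addvA [(phi S + _)%VS]addvC.
have : (\dim (X :&: Y + phi (S :&: A))
          <= \dim ((X + phi S) :&: (Y + phi A)))%N.
  rewrite dimvS // subv_cap phiI.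
  by rewrite !addvS ?capvSl ?capvSr.
have := cardsUI S A; have := rank_submod N S A; lia.
Qed.

Definition ext_qmatroid : qmatroid 'rV[F]_n :=
  QMatroid ext_rank_dim ext_rank_mono ext_rank_submod.

(** A minimizer [S] for [X] gives the same bound for [X + phi S], so flatness yields [phi S <= X];
    then [phi S] and [X] have equal nullity, and cyclicity makes them equal. *)
Lemma ext_coordinate : coordinate_qmatroid ext_qmatroid.
Proof.
move=> X [flX cyX]; have [S eS] := ext_rank_attained X.
have SX : (phi S <= X)%VS.
  apply: qflat_sub flX _; have := ext_rank_le (X + phi S)%VS S.
  by rewrite -addvA addvv -eS leq_add2r.
exists S; apply/esym; apply: (qcyclic_sub cyX SX).
by rewrite /= ext_rank_phi dim_phi eS (addv_idPl SX).
Qed.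

Lemma ext_cyclic_flatP S : cyclic_flat N S <-> qcyclic_flat ext_qmatroid (phi S).
Proof.
split=> [[flS cyS]|/qcyclic_flat_phi[flS cyS]]; last first.
  split=> s sS; first by have := flS s sS; rewrite /= /coord_rank /= !ext_rank_phi.
  by have := cyS s sS; rewrite /= /coord_rank /= !ext_rank_phi.
(* Both halves below place a minimizer [A] inside [S] by this criterion. *)
have sub A : (N A + #|A :|: S| <= N S + #|A|)%N -> A \subset S.
  move=> le; apply: flat_sub flS _.
  by have := rank_le_codim N (finset.subsetUl A S); lia.
split=> [v vS|H HS dH] /=.
  rewrite ext_rank_phi ltnNge; apply/negP => le.
  have [A eA] := ext_rank_attained (phi S + <[v]>)%VS.
  rewrite -addvA [(<[v]> + _)%VS]addvC addvA -phiU finset.setUC in eA.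
  have {}le : (N A + \dim (phi (A :|: S) + <[v]>) <= N S + #|A|)%N.
    by rewrite -eA leq_add2r.
  have AS : A \subset S.
    apply: sub; apply: leq_trans le.
    by rewrite leq_add2l -(dim_phi F) dimv_addl.
  (* The extra dimension from [v] would make the nullity of [A] exceed that of [S]. *)
  have := rank_le_codim N AS.
  by rewrite (finset.setUidPr AS) dimv_add_vline // dim_phi in le; lia.
rewrite ext_rank_phi; apply/eqP; rewrite eqn_leq.
have := ext_rank_mono HS; rewrite ext_rank_phi => -> /=.
rewrite leqNgt; apply/negP => lt.
have [A eA] := ext_rank_attained H.
have dHA : (\dim (phi (A :|: S)) <= (\dim (H + phi A)).+1)%N.
  by rewrite phiU addvC; exact: dimv_add_hyperplane HS dH.
rewrite dim_phi in dHA.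
have {}lt : (N A + \dim (H + phi A) < N S + #|A|)%N by rewrite -eA ltn_add2r.
have AS : A \subset S.
  by apply: sub; apply: leq_trans lt; rewrite -addnS leq_add2l.
(* The strict inequality [lt] makes up for the one dimension lost in [H], so [A] has at least the
   nullity of [S]. *)
rewrite (finset.setUidPr AS) in dHA.
have eAS : A = S.
  by apply: (cyclic_sub cyS AS); apply: leq_trans lt; rewrite -addnS leq_add2l.
by rewrite eAS (addv_idPr HS) dim_phi ltnn in lt.
Qed.

End Extension.

(** * Transport of the weighted cyclic flats in both directions *)

Theorem lemma3p3 (F : finFieldType) (n : nat) :
  (forall M : qmatroid 'rV[F]_n, coordinate_qmatroid M ->
     forall (Z : set {vspace 'rV[F]_n}) (lam : {vspace 'rV[F]_n} -> nat),
     qweighted_cyclic_flats M Z lam ->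
     exists N : matroid 'I_n,
       weighted_cyclic_flats N (@phi_inv F n @` Z)%classic (lam \o @phi F n)) /\
  (forall (N : matroid 'I_n) (Z : set {set 'I_n}) (lam : {set 'I_n} -> nat),
     weighted_cyclic_flats N Z lam ->
     exists M : qmatroid 'rV[F]_n, coordinate_qmatroid M /\
       qweighted_cyclic_flats M (@phi F n @` Z)%classic (lam \o @phi_inv F n)).
Proof.
split=> [M coM Z lam [-> lamE]|N Z lam [-> lamE]].
  exists (coord_matroid M); split.
    apply/seteqP; split=> [_ [X cfX <-]|S /(coord_cyclic_flatP _ coM) cfS].
      have [S eX] := coM _ cfX; rewrite eX phiK; apply: qcyclic_flat_phi.
      by rewrite -eX.
    by exists (phi F S) => //; rewrite phiK.
  move=> _ [X cfX <-]; have [S eX] := coM _ cfX.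
  by rewrite eX phiK /= lamE // -eX.
exists (ext_qmatroid F N); split; first exact: ext_coordinate.
split.
  apply/seteqP; split=> [_ [S cfS <-]|X cfX]; first exact/ext_cyclic_flatP.
  have [S eX] := ext_coordinate cfX.
  by exists S => //; apply/(ext_cyclic_flatP F); rewrite -eX.
by move=> _ [S cfS <-] /=; rewrite phiK ext_rank_phi lamE.
Qed.
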